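(* Let $(Y,d_Y)$ be a metric space, let $Z\subseteq Y$ be closed, and let $X:=Y\sqcup_Z Y$ be the metric space formed by gluing two copies of $Y$ along $Z$. Let $\phi\colon Y\to H'$ be a map into a Hilbert space, and define $\Psi\colon X\to H'\times\mathbb R$ by $$\Psi(y,\delta):=\Big(\phi(y),\ \delta\inf_{z\in Z}d_Y(y,z)\Big).$$ Then $\kappa(\Psi)\leq\sqrt2\cdot\sqrt{\kappa(\phi)^2+1}$. Moreover, we obtain the two-sided bound $$c_2(Y)\leq c_2(X)\leq\sqrt2\cdot\sqrt{c_2(Y)^2+1}.$$
   Context: Gluing: $Y\sqcup_Z Y:=(Y\times\{\pm1\})/{\sim_Z}$, where $\sim_Z$ identifies $(z,1)$ with $(z,-1)$ for each $z\in Z$, equipped with the metric $$d\big((y,\delta),(y',\delta')\big)=\begin{cases}d_Y(y,y')&\text{if }\delta=\delta',\\ \inf_{z\in Z}\big(d_Y(y,z)+d_Y(z,y')\big)&\text{if }\delta=-\delta'.\end{cases}$$ For a map $f\colon X\to Y$ of metric spaces, let $\alpha,\beta\in[0,\infty]$ be the largest and smallest constants (respectively) with $\alpha\, d_X(x,x')\le d_Y(f(x),f(x'))\le\beta\, d_X(x,x')$ for all $x,x'\in X$; the distortion of $f$ is $\kappa(f):=\beta/\alpha$, where $\kappa(f)=\infty$ if $\alpha=0$ or $\beta=\infty$. The Euclidean distortion $c_2(X)\in[1,\infty]$ is the infimum of all $c$ for which there exist a Hilbert space $H$ and a map $f\colon X\to H$ with $\kappa(f)=c$. The space $H'\times\mathbb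 R$ carries the product Hilbert space structure.
   Formalization: The bound on κ(Ψ) is false for arbitrary φ since κ(Ψ) changes when φ is rescaled; it is stated for φ normalized so that α ≤ 1 ≤ β (required only if Y has two points and κ(φ) is finite), and Z is assumed nonempty. *)

(* Defs.v *)
From HB Require Import structures.
From mathcomp Require Import all_boot all_order all_algebra generic_quotient.
From mathcomp Require Import all_classical all_reals all_analysis.
From mathcomp Require Import ring.

Set Implicit Arguments.
Unset Strict Implicit.
Unset Printing Implicit Defensive.

Import Order.TTheory GRing.Theory Num.Theory.
Import numFieldNormedType.Exports.

Local Open Scope classical_set_scope.
Local Open Scope ring_scope.

(* Real Hilbert spaces.  The library attaches no distance [mdist] to an
   abstract normed module, hence the last field. *)
HB.mixin Record CompleteNormedModule_isHilbert (R : realType) H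
    & CompleteNormedModule R H & Metric R H := {
  inner : H -> H -> R ;
  innerC : forall u v, inner u v = inner v u ;
  inner_linearl : forall (a : R) (u v w : H),
    inner (a *: u + v) w = a * inner u w + inner v w ;
  inner_norm : forall u, inner u u = `|u| ^+ 2 ;
  mdist_norm : forall u v : H, mdist u v = `|u - v|
}.

#[short(type="hilbertType")]
HB.structure Definition Hilbert (R : realType) :=
  { H of CompleteNormedModule R H & Metric R H
       & CompleteNormedModule_isHilbert R H }.

Section HilbertRegular.
Variable R : realType.

Let inner_R (x y : R^o) : R := x * y.

Let inner_RC x y : inner_R x y = inner_R y x.
Proof. exact: mulrC. Qed.

Let inner_R_linearl (a : R) (u v w : R^o) :
  inner_R (a *: u + v) w = a * inner_R u w + inner_R v w.
Proof. by rewrite /inner_R mulrDl mulrA. Qed.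

Let inner_R_norm (u : R^o) : inner_R u u = `|u| ^+ 2.
Proof. by rewrite /inner_R -expr2 -normrX ger0_norm// sqr_ge0. Qed.

Let mdist_R_norm (u v : R^o) : mdist u v = `|u - v|.
Proof. by rewrite distrC. Qed.

HB.instance Definition _ := CompleteNormedModule_isHilbert.Build R R^o
  inner_RC inner_R_linearl inner_R_norm mdist_R_norm.

End HilbertRegular.

Section HilbertTheory.
Variables (R : realType) (H : hilbertType R).
Implicit Types u v : H.

Lemma innerDl u v w : inner (u + v) w = inner u w + inner v w.
Proof. by rewrite -[u in LHS]scale1r inner_linearl mul1r. Qed.

Lemma inner0l w : inner (0 : H) w = 0.
Proof. by apply: (addrI (inner 0 w)); rewrite -innerDl !addr0. Qed.

Lemma innerZl a u w : inner (a *: u) w = a * inner u w.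
Proof. by rewrite -[a *: u]addr0 inner_linearl inner0l addr0. Qed.

Lemma CauchySchwarz u v : inner u v <= `|u| * `|v|.
Proof.
have [->|v0] := eqVneq v 0; first by rewrite innerC inner0l normr0 mulr0.
have [->|u0] := eqVneq u 0; first by rewrite inner0l normr0 mul0r.
have nu : 0 < `|u| by rewrite normr_gt0.
have nv : 0 < `|v| by rewrite normr_gt0.
set w := `|v| *: u - `|u| *: v.
have : 0 <= inner w w by rewrite inner_norm sqr_ge0.
have -> : inner w w = 2 * (`|u| * `|v|) * (`|u| * `|v| - inner u v).
  rewrite /w -scaleNr innerDl !innerZl ![inner _ (_ + _)]innerC !innerDl !innerZl.
  by rewrite !inner_norm [inner v u]innerC; ring.
by rewrite pmulr_rge0 ?subr_ge0// !mulr_gt0.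
Qed.

End HilbertTheory.

(* The product Hilbert space.  An alias is needed because [H * K] itself
   canonically carries the max norm. *)
Definition hprod (R : realType) (H K : hilbertType R) : Type := (H * K)%type.

Section HilbertProduct.
Variables (R : realType) (H K : hilbertType R).
Local Notation HK := (hprod H K).

HB.instance Definition _ := GRing.Lmodule.copy HK (H * K)%type.

Definition hprod_norm (p : HK) : R := Num.sqrt (`|p.1| ^+ 2 + `|p.2| ^+ 2).

Let sq_ge0 (p : HK) : 0 <= `|p.1| ^+ 2 + `|p.2| ^+ 2.
Proof. by rewrite addr_ge0// sqr_ge0. Qed.

Let inner_p (p q : HK) : R := inner p.1 q.1 + inner p.2 q.2.

Let inner_pC p q : inner_p p q = inner_p q p.
Proof. by rewrite /inner_p innerC [inner p.2 _]innerC. Qed.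

Let inner_p_linearl (a : R) (u v w : HK) :
  inner_p (a *: u + v) w = a * inner_p u w + inner_p v w.
Proof. by rewrite /inner_p /= !inner_linearl mulrDr addrACA. Qed.

Let inner_p_sq p : inner_p p p = hprod_norm p ^+ 2.
Proof. by rewrite /inner_p !inner_norm sqr_sqrtr. Qed.

Let norm1_le (p : HK) : `|p.1| <= hprod_norm p.
Proof. by rewrite -[leLHS]ger0_norm// -sqrtr_sqr ler_sqrt// lerDl sqr_ge0. Qed.

Let norm2_le (p : HK) : `|p.2| <= hprod_norm p.
Proof. by rewrite -[leLHS]ger0_norm// -sqrtr_sqr ler_sqrt// lerDr sqr_ge0. Qed.

Let norm_le (p : HK) : hprod_norm p <= `|p.1| + `|p.2|.
Proof.
rewrite -[leRHS]ger0_norm ?addr_ge0// -sqrtr_sqr ler_sqrt ?sqr_ge0//.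
by rewrite sqrrD addrAC lerDl mulrn_wge0// mulr_ge0.
Qed.

Let inner_p_CS (p q : HK) : inner_p p q <= hprod_norm p * hprod_norm q.
Proof.
rewrite -sqrtrM//.
have h : inner_p p q <= `|p.1| * `|q.1| + `|p.2| * `|q.2|.
  by rewrite lerD ?CauchySchwarz.
apply: (le_trans h).
rewrite -[leLHS]ger0_norm ?addr_ge0 ?mulr_ge0// -sqrtr_sqr.
rewrite ler_sqrt ?mulr_ge0//.
rewrite -subr_ge0.
set a := `|p.1|; set b := `|p.2|; set c := `|q.1|; set d := `|q.2|.
have -> : (a ^+ 2 + b ^+ 2) * (c ^+ 2 + d ^+ 2) - (a * c + b * d) ^+ 2
  = (a * d - b * c) ^+ 2 by ring.
exact: sqr_ge0.
Qed.

Let norm_D (p q : HK) : hprod_norm (p + q) <= hprod_norm p + hprod_norm q.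
Proof.
rewrite -(@ler_pXn2r _ 2)// ?nnegrE ?addr_ge0 ?sqrtr_ge0//.
rewrite -inner_p_sq.
have -> : inner_p (p + q) (p + q)
    = hprod_norm p ^+ 2 + inner_p p q *+ 2 + hprod_norm q ^+ 2.
  rewrite -!inner_p_sq /inner_p /= !innerDl ![inner _ (_ + _)]innerC !innerDl.
  by rewrite [inner q.1 p.1]innerC [inner q.2 p.2]innerC; ring.
by rewrite sqrrD lerD2r lerD2l lerMn2r inner_p_CS orbT.
Qed.

Let norm_Z (l : R) (p : HK) : hprod_norm (l *: p) = `|l| * hprod_norm p.
Proof.
rewrite /hprod_norm /= !normrZ !exprMn -mulrDr sqrtrM ?sqr_ge0//.
by rewrite sqrtr_sqr normr_id.
Qed.

Let norm_eq0 (p : HK) : hprod_norm p = 0 -> p = 0.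
Proof.
move=> p0; case: p p0 => a b p0.
have := norm1_le (a, b); have := norm2_le (a, b); rewrite p0 /=.
by rewrite !normr_le0 => /eqP -> /eqP ->.
Qed.

HB.instance Definition _ :=
  Lmodule_isNormed.Build R HK norm_D norm_Z norm_eq0.

Let hprod_complete (F : set_system HK) :
  ProperFilter F -> cauchy F -> cvg F.
Proof.
move=> FF /cauchyP Fc.
have c1 : cvg ((@fst H K : HK -> H) @ F).
  apply: cauchy_cvg; apply/cauchyP => e e0.
  have [p Fp] := Fc _ e0; exists p.1.
  suff : F [set q : HK | ball p.1 e q.1] by [].
  apply: filterS Fp => q; rewrite /= -!ball_normE /=.
  exact: (le_lt_trans (norm1_le (p - q))).
have c2 : cvg ((@snd H K : HK -> K) @ F).
  apply: cauchy_cvg; apply/cauchyP => e e0.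
  have [p Fp] := Fc _ e0; exists p.2.
  suff : F [set q : HK | ball p.2 e q.2] by [].
  apply: filterS Fp => q; rewrite /= -!ball_normE /=.
  exact: (le_lt_trans (norm2_le (p - q))).
move: c1 c2 => /cvg_ex[/= a Fa] /cvg_ex[/= b Fb].
apply/cvg_ex; exists ((a, b) : HK).
apply/cvgrPdist_lt => e e0.
have e2 : 0 < e / 2 by rewrite divr_gt0.
move/cvgrPdist_lt: Fa => /(_ _ e2) Fa; move/cvgrPdist_lt: Fb => /(_ _ e2) Fb.
near=> q.
have le := norm_le ((a, b) - q : HK).
apply: (le_lt_trans le); rewrite [ltRHS]splitr ltrD//=.
- by near: q.
- by near: q.
Unshelve. all: by end_near. Qed.

HB.instance Definition _ := Uniform_isComplete.Build HK hprod_complete.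

Let hdist (p q : HK) : R := `|p - q|.

Let hdist_ge0 p q : 0 <= hdist p q.
Proof. exact: normr_ge0. Qed.

Let hdist_positivity p q : hdist p q = 0 -> p = q.
Proof. by move/normr0_eq0/eqP; rewrite subr_eq0 => /eqP. Qed.

Let hdist_ball p d : ball p d = [set q | hdist p q < d].
Proof. by rewrite -ball_normE. Qed.

HB.instance Definition _ :=
  PseudoMetric_isMetric.Build R HK hdist_ge0 hdist_positivity hdist_ball.

HB.instance Definition _ := CompleteNormedModule_isHilbert.Build R HK
  inner_pC inner_p_linearl inner_p_sq (fun _ _ => erefl).

End HilbertProduct.

Section Distortion.
Context {R : realType}.
Local Open Scope ereal_scope.

Definition lower_lip (X Y : metricType R) (f : X -> Y) : \bar R :=
  ereal_sup [set a | 0 <= a /\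
    forall x x', a * (mdist x x')%:E <= (mdist (f x) (f x'))%:E].

Definition upper_lip (X Y : metricType R) (f : X -> Y) : \bar R :=
  ereal_inf [set b | 0 <= b /\
    forall x x', (mdist (f x) (f x'))%:E <= b * (mdist x x')%:E].

(* If X is a single point, then [lower_lip f] is [+oo], [upper_lip f] is 0 and
   the quotient is 0 / +oo = 0. *)
Definition distortion (X Y : metricType R) (f : X -> Y) : \bar R :=
  if (lower_lip f == 0) || (upper_lip f == +oo) then +oo
  else upper_lip f / lower_lip f.

Definition euclidean_distortion (X : metricType R) : \bar R :=
  ereal_inf [set c | exists (H : hilbertType R) (f : X -> H), distortion f = c].

(* [distortion f] is invariant under rescaling f, but the distortion of the
   extension [glue_ext] below is not, since its second component has a fixed
   scale.  With Y = {y, z}, d y z = 1, Z = {z}, phi y = 10 and phi z = 0, the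
   map phi has distortion 1 and its extension has distortion sqrt 101 > 2, so
   that bounding the latter requires a normalisation of phi.  The one below
   contains both usual ones, [lower_lip f = 1] and [upper_lip f = 1]; it is met
   by every map after multiplication by a suitable positive constant, and it is
   no constraint when the domain is a single point or f has infinite
   distortion. *)
Definition normalized (X Y : metricType R) (f : X -> Y) : Prop :=
  (exists x x' : X, x <> x') -> distortion f < +oo ->
  lower_lip f <= 1 <= upper_lip f.

End Distortion.

(* The sheets {1, -1} are encoded by bool, [d] standing for (-1) ^+ d. *)
Section GlueDistance.
Variables (R : realType) (Y : metricType R) (Z : set Y).

Definition glue_rel (p q : Y * bool) : bool :=
  (p == q) || ((p.1 == q.1) && (p.1 \in Z)).

Lemma glue_rel_refl : reflexive glue_rel.
Proof. by move=> p; rewrite /glue_rel eqxx. Qed.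

Lemma glue_rel_sym : symmetric glue_rel.
Proof.
move=> p q; rewrite /glue_rel eq_sym [p.1 == _]eq_sym.
by case: (q.1 =P p.1) => //= ->.
Qed.

Lemma glue_rel_trans : transitive glue_rel.
Proof.
move=> q p r; rewrite /glue_rel => /orP[/eqP -> //|/andP[/eqP pq pZ]].
by move=> /orP[/eqP <-|/andP[/eqP qr _]]; rewrite pZ pq ?qr eqxx orbT.
Qed.

Canonical glue_equiv :=
  EquivRel glue_rel glue_rel_refl glue_rel_sym glue_rel_trans.

Definition glue_dist (p q : Y * bool) : R :=
  if p.2 == q.2 then mdist p.1 q.1
  else inf [set mdist p.1 z + mdist z q.1 | z in Z].

Definition dist_to (y : Y) : R := inf [set mdist y z | z in Z].

Hypothesis Z0 : Z !=set0.

Lemma dist_to_eq0 y : Z y -> dist_to y = 0.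
Proof.
move=> Zy; apply/eqP; rewrite eq_le; apply/andP; split.
  apply: ge_inf; last by exists y => //; rewrite mdistxx.
  by exists 0 => _ [z _ <-]; exact: mdist_ge0.
apply: lb_le_inf; first by exists (mdist y y), y.
by move=> _ [z _ <-]; exact: mdist_ge0.
Qed.

Let cross (y y' : Y) : R := inf [set mdist y z + mdist z y' | z in Z].

Let cross_le y y' z : Z z -> cross y y' <= mdist y z + mdist z y'.
Proof.
move=> Zz; apply: ge_inf; last by exists z.
by exists 0 => _ [w _ <-]; rewrite addr_ge0// mdist_ge0.
Qed.

Let le_cross y y' m : (forall z, Z z -> m <= mdist y z + mdist z y') ->
  m <= cross y y'.
Proof.
move=> h; apply: lb_le_inf => [|_ [z Zz <-]]; last exact: h.
by case: Z0 => z Zz; exists (mdist y z + mdist z y'), z.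
Qed.

Let crossC y y' : cross y y' = cross y' y.
Proof.
congr inf; apply/seteqP; split => _ [z Zz <-]; exists z => //;
  by rewrite addrC metric_sym [mdist z _]metric_sym.
Qed.

Let mdist_le_cross y y' : mdist y y' <= cross y y'.
Proof. by apply: le_cross => z _; exact: metric_triangle. Qed.

Let crossD y y' w : cross y w <= mdist y y' + cross y' w.
Proof.
rewrite -lerBlDl; apply: le_cross => z Zz; rewrite lerBlDl addrA.
by apply: (le_trans (cross_le _ _ Zz)); rewrite lerD2r metric_triangle.
Qed.

Let cross_tri y y' w : mdist y w <= cross y y' + cross y' w.
Proof.
exact: (le_trans (metric_triangle y y' w) (lerD (mdist_le_cross _ _) (mdist_le_cross _ _))).
Qed.

Let cross_Z y y' : Z y -> cross y y' = mdist y y'.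
Proof.
move=> Zy; apply/eqP; rewrite eq_le mdist_le_cross andbT.
by rewrite (le_trans (cross_le _ _ Zy))// mdistxx add0r.
Qed.

Lemma glue_distxx p : glue_dist p p = 0.
Proof. by rewrite /glue_dist eqxx mdistxx. Qed.

Lemma glue_dist_sym p q : glue_dist p q = glue_dist q p.
Proof.
rewrite /glue_dist eq_sym; case: ifP => _; first exact: metric_sym.
exact: crossC.
Qed.

Lemma glue_dist_triangle q p r : glue_dist p r <= glue_dist p q + glue_dist q r.
Proof.
case: p q r => [y a] [y' b] [w c]; rewrite /glue_dist /= -!/(cross _ _).
case: a b c => [] [] [] /=; rewrite ?metric_triangle ?crossD ?cross_tri//.
all: by rewrite crossC [cross y y']crossC addrC [mdist y' w]metric_sym crossD.
Qed.

Lemma glue_dist_eq0 p q : closed Z -> glue_dist p q = 0 -> glue_rel p q.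
Proof.
case: p q => [y a] [y' b] clZ; rewrite /glue_dist /glue_rel /= -/(cross _ _).
case: eqP => [-> /mdist_positivity -> |_ c0]; first by rewrite eqxx.
have yy' : y = y'.
  by apply: mdist_positivity; apply/eqP; rewrite eq_le mdist_ge0 -c0 mdist_le_cross.
rewrite -{}yy' in c0 *; rewrite eqxx /= orbC; apply/orP; left.
rewrite inE; apply: clZ => U /nbhs_ballP[e /= e0 eU].
apply: contrapT => UZ.
suff : e <= 0 by rewrite leNgt e0.
rewrite -c0; apply: le_cross => z Zz.
rewrite leNgt; apply/negP => ze; apply: UZ; exists z; split => //; apply: eU.
rewrite ballEmdist /=; apply: le_lt_trans ze.
by rewrite lerDl mdist_ge0.
Qed.

Lemma glue_dist_compat p q r : glue_rel p q -> glue_dist p r = glue_dist q r.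
Proof.
case: p q r => [y a] [y' b] [w c].
rewrite /glue_rel /= => /orP[/eqP -> //|/andP[/eqP <-]]; rewrite inE => Zy.
by rewrite /glue_dist /= -!/(cross _ _) cross_Z//; do 2 case: ifP.
Qed.

End GlueDistance.

(* The two proof arguments are what makes the distance a metric. *)
Definition gluing (R : realType) (Y : metricType R) (Z : set Y)
  (clZ : closed Z) (Z0 : Z !=set0) : Type := {eq_quot glue_rel Z}%qT.

Section Glue.
Variables (R : realType) (Y : metricType R) (Z : set Y).
Variables (clZ : closed Z) (Z0 : Z !=set0).
Local Notation X := (gluing clZ Z0).

HB.instance Definition _ := EqQuotient.copy X {eq_quot glue_rel Z}%qT.
HB.instance Definition _ := Choice.copy X {eq_quot glue_rel Z}%qT.

Definition glue_pi (y : Y) (d : bool) : X := (\pi_X (y, d))%qT.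

Let gdist (x x' : X) : R := glue_dist Z (repr x) (repr x').

Let reprP (p : Y * bool) : glue_rel Z (repr (\pi_X p)%qT) p.
Proof. by apply/eqmodP; rewrite reprK. Qed.

Let gdistxx x : gdist x x = 0.
Proof. exact: glue_distxx. Qed.

Let gdist_positivity x x' : gdist x x' = 0 -> x = x'.
Proof.
move=> /(glue_dist_eq0 Z0 clZ) h; rewrite -[x]reprK -[x']reprK.
exact/eqmodP.
Qed.

Let gdist_sym x x' : gdist x x' = gdist x' x.
Proof. exact: glue_dist_sym. Qed.

Let gdist_triangle y x z : gdist x z <= gdist x y + gdist y z.
Proof. exact: glue_dist_triangle. Qed.

HB.instance Definition _ :=
  isMetric.Build R X gdistxx gdist_positivity gdist_sym gdist_triangle.

Lemma glue_piP (x : X) : exists y d, x = glue_pi y d.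
Proof.
by exists (repr x).1, (repr x).2; rewrite /glue_pi -surjective_pairing reprK.
Qed.

Lemma glue_pi_eq y d y' d' :
  glue_pi y d = glue_pi y' d' <-> (y, d) = (y', d') \/ (y = y' /\ Z y).
Proof.
split=> [/eqmodP/orP[/eqP ->|/andP[/eqP /= -> /set_mem]]|]; try by [left|right].
move=> h; apply/eqmodP/orP; case: h => [->|[-> Zy]]; [left|right] => //=.
by rewrite eqxx/= inE.
Qed.

Lemma mdist_glue_pi y d y' d' :
  mdist (glue_pi y d) (glue_pi y' d') =
  if d == d' then mdist y y' else inf [set mdist y z + mdist z y' | z in Z].
Proof.
transitivity (glue_dist Z (y, d) (y', d')) => //.
transitivity (gdist (glue_pi y d) (glue_pi y' d')) => //.
rewrite /gdist (glue_dist_compat Z0 _ (reprP _)) glue_dist_sym.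
by rewrite (glue_dist_compat Z0 _ (reprP _)) glue_dist_sym.
Qed.

(* By [glue_extE], this does not depend on the choice of representatives. *)
Definition glue_ext (H : hilbertType R) (phi : Y -> H) (x : X) : hprod H R^o :=
  (phi (repr x).1, (-1) ^+ (repr x).2 * dist_to Z (repr x).1).

Lemma glue_extE (H : hilbertType R) (phi : Y -> H) y d :
  glue_ext phi (glue_pi y d) = (phi y, (-1) ^+ d * dist_to Z y).
Proof.
rewrite /glue_ext; have := reprP (y, d); rewrite -/(glue_pi y d).
case: (repr _) => y' d' /orP[/eqP [-> ->] //|/andP[/= /eqP -> /set_mem Zy]].
by rewrite (dist_to_eq0 Zy) !mulr0.
Qed.

End Glue.

Arguments glue_ext {R Y Z} clZ Z0 {H} phi x.

(* Main.v *)
Require Import Defs.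
From mathcomp Require Import all_boot all_order all_algebra.
From mathcomp Require Import all_classical all_reals all_analysis.
From mathcomp Require Import ring lra.
Import Order.TTheory GRing.Theory Num.Theory.
Import numFieldNormedType.Exports.

Local Open Scope classical_set_scope.
Local Open Scope ring_scope.

(* Let a <= 1 <= b with a d(y,y') <= |phi y - phi y'| <= b d(y,y'), and write t
   for the distance to Z.  The cross-sheet distance D of y and y' satisfies
   max(d, t y + t y') <= D <= d + t y + t y'.  Hence Psi is sqrt(b^2 + 1)-Lipschitz
   and, by Cauchy-Schwarz, expands by at least 1 / sqrt(1 + 1/a^2).  The resulting
   ratio is at most sqrt 2 sqrt((b/a)^2 + 1) because (b^2 - 1)(1 - a^2) >= 0.  For the
   bound on c_2, rescale phi so that a = 1; the bound passes to the infimum because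
   c |-> sqrt 2 sqrt(c^2 + 1) has an adjoint. *)

(** * Lipschitz constants and distortion as extended reals *)

Section Distortion.
Set Implicit Arguments.
Unset Strict Implicit.
Context {R : realType}.
Implicit Types X Y : metricType R.
Local Open Scope ereal_scope.

Lemma lower_lip_ge0 X Y (f : X -> Y) : 0 <= lower_lip f.
Proof.
by apply: ereal_sup_ubound; split=> // x x'; rewrite mul0e lee_fin mdist_ge0.
Qed.

Lemma upper_lip_ge0 X Y (f : X -> Y) : 0 <= upper_lip f.
Proof. by apply: le_ereal_inf_tmp => b []. Qed.

(** The supremum is itself admissible: at positive distance every admissible constant is below the
    quotient of distances, and at distance 0 the convention +oo * 0 = 0 applies. *)
Lemma lower_lip_le_mdist X Y (f : X -> Y) x x' :
  lower_lip f * (mdist x x')%:E <= (mdist (f x) (f x'))%:E.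
Proof.
have [->|xx'] := eqVneq (mdist x x') 0%R; first by rewrite mule0 lee_fin mdist_ge0.
have d0 : (0 < mdist x x')%R by rewrite lt0r xx' mdist_ge0.
rewrite -lee_pdivlMr//; apply: ge_ereal_sup => a [_ /(_ x x')].
by rewrite lee_pdivlMr.
Qed.

Lemma mdist_le_upper_lip X Y (f : X -> Y) x x' :
  upper_lip f < +oo ->
  (mdist (f x) (f x'))%:E <= upper_lip f * (mdist x x')%:E.
Proof.
have [xx' _|xx' uoo] := eqVneq (mdist x x') 0%R.
  by rewrite (mdist_positivity _ _ xx') !mdistxx mule0.
have d0 : (0 < mdist x x')%R by rewrite lt0r xx' mdist_ge0.
rewrite -lee_pdivrMr//; apply: le_ereal_inf_tmp => a [_ /(_ x x')].
by rewrite lee_pdivrMr.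
Qed.

Lemma distortion_le X Y (f : X -> Y) (a b : \bar R) :
  0 < a -> b < +oo -> a <= lower_lip f -> upper_lip f <= b ->
  distortion f <= b / a.
Proof.
move=> a0 boo al ub.
have l0 : 0 < lower_lip f := lt_le_trans a0 al.
have uoo : upper_lip f < +oo := le_lt_trans ub boo.
rewrite /distortion gt_eqF//= lt_eqF//=.
apply: lee_pmul => //; first exact: upper_lip_ge0.
  by rewrite inve_ge0 ltW.
rewrite lee_pV2// inE; exact: ltW.
Qed.

Lemma distortion_ge0 X Y (f : X -> Y) : 0 <= distortion f.
Proof.
rewrite /distortion; case: ifP => // _.
by rewrite mule_ge0 ?inve_ge0 ?upper_lip_ge0 ?lower_lip_ge0.
Qed.

Lemma distortion_lt_pinfty X Y (f : X -> Y) :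
  distortion f < +oo ->
  [/\ 0 < lower_lip f, upper_lip f < +oo &
      distortion f = upper_lip f / lower_lip f].
Proof.
rewrite /distortion; case: ifP => //= /norP[l0 uoo] _.
by rewrite lt0e l0 lower_lip_ge0 ltey.
Qed.

(** Constants admissible for [f] stay admissible for [f \o i]. Used with [i] the inclusion of one
    sheet. *)
Lemma distortion_isometry X' X Y (i : X' -> X) (f : X -> Y) :
  (forall x x', mdist (i x) (i x') = mdist x x') ->
  distortion (f \o i) <= distortion f.
Proof.
move=> iE; have [->|] := eqVneq (distortion f) +oo; first exact: leey.
rewrite -ltey => /distortion_lt_pinfty[l0 uoo ->].
apply: distortion_le => //.
- by apply: ereal_sup_le => a [a0 fa]; split => // x x'; rewrite -(iE x x');
    exact: fa.
- by apply: ereal_inf_le_tmp => b [b0 fb]; split => // x x'; rewrite -(iE x x');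
    exact: fb.
Qed.

Lemma distortion_le_fin X Y (f : X -> Y) (a b : R) : (0 < a)%R -> (0 <= b)%R ->
  (forall x x', a * mdist x x' <= mdist (f x) (f x') <= b * mdist x x')%R ->
  distortion f <= (b / a)%:E.
Proof.
move=> a0 b0 fab.
suff -> : (b / a)%:E = b%:E / a%:E.
  apply: distortion_le; rewrite ?lte_fin ?ltry//.
  - apply: ereal_sup_ubound; split; first by rewrite lee_fin ltW.
    by move=> x x'; rewrite -EFinM lee_fin; case/andP: (fab x x').
  - apply: ereal_inf_lbound; split; first by rewrite lee_fin.
    by move=> x x'; rewrite -EFinM lee_fin; case/andP: (fab x x').
by rewrite EFinM inver gt_eqF.
Qed.

Lemma distortion_subsingleton X Y (f : X -> Y) :
  (forall x x' : X, x = x') -> distortion f = 0.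
Proof.
move=> Xs.
have lE : lower_lip f = +oo.
  apply/eqP; rewrite -leye_eq; apply: ereal_sup_ubound; split => // x x'.
  by rewrite (Xs x x') !mdistxx mule0.
have uE : upper_lip f = 0.
  apply/eqP; rewrite eq_le upper_lip_ge0 andbT.
  apply: ereal_inf_lbound; split => // x x'.
  by rewrite (Xs x x') !mdistxx mule0.
by rewrite /distortion lE uE /= mul0e.
Qed.

Lemma distortion_finP X Y (f : X -> Y) :
  (exists x x' : X, x <> x') -> distortion f < +oo ->
  exists a b : R, [/\ (0 < a <= b)%R,
    lower_lip f = a%:E, upper_lip f = b%:E, distortion f = (b / a)%:E &
    forall x x', (a * mdist x x' <= mdist (f x) (f x') <= b * mdist x x')%R].
Proof.
move=> [x [x' xx']] /distortion_lt_pinfty[l0 uoo ->].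
have d0 : (0 < mdist x x')%R.
  by rewrite lt0r mdist_ge0 andbT; apply/eqP => /mdist_positivity.
have lo := lower_lip_le_mdist f; have up x1 x2 := mdist_le_upper_lip x1 x2 uoo.
have := upper_lip_ge0 f.
case: (upper_lip f) uoo up => [b| |]// _ up _.
have := lo x x'; case: (lower_lip f) l0 lo => [a| |]//; last first.
  (* An infinite lower constant would make the distance of the images of [x] and [x'] infinite. *)
  by rewrite mulyr gtr0_sg// mul1e.
rewrite lte_fin => a0 lo lexx'.
have fab x1 x2 : (a * mdist x1 x2 <= mdist (f x1) (f x2) <= b * mdist x1 x2)%R.
  by rewrite -!lee_fin !EFinM lo up.
exists a, b; split => //; last by rewrite EFinM inver gt_eqF.
rewrite a0 -(ler_pM2r d0).
by case/andP: (fab x x'); exact: le_trans.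
Qed.

End Distortion.

(** * Distance to [Z] and distance across the sheets *)

Section Gluing.
Set Implicit Arguments.
Unset Strict Implicit.
Context {R : realType} {Y : metricType R} {Z : set Y}.
Variables (clZ : closed Z) (Z0 : Z !=set0).
Implicit Types y : Y.

Local Notation cross y y' := (inf [set mdist y z + mdist z y' | z in Z]).

Lemma dist_to_le y z : Z z -> dist_to Z y <= mdist y z.
Proof.
move=> Zz; apply: ge_inf; last by exists z.
by exists 0 => _ [w _ <-]; exact: mdist_ge0.
Qed.

Lemma le_dist_to y m : (forall z, Z z -> m <= mdist y z) -> m <= dist_to Z y.
Proof.
move=> mz; apply: lb_le_inf => [|_ [z Zz <-]]; last exact: mz.
by case: Z0 => z Zz; exists (mdist y z), z.
Qed.

Lemma dist_to_ge0 y : 0 <= dist_to Z y.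
Proof. by apply: le_dist_to => z _; exact: mdist_ge0. Qed.

Lemma dist_to_lip y y' : dist_to Z y - dist_to Z y' <= mdist y y'.
Proof.
rewrite lerBlDr -lerBlDl; apply: le_dist_to => z Zz.
by rewrite lerBlDl (le_trans (dist_to_le y Zz))// metric_triangle.
Qed.

Lemma cross_le y y' z : Z z -> cross y y' <= mdist y z + mdist z y'.
Proof.
move=> Zz; apply: ge_inf; last by exists z.
by exists 0 => _ [w _ <-]; rewrite addr_ge0// mdist_ge0.
Qed.

Lemma le_cross y y' m : (forall z, Z z -> m <= mdist y z + mdist z y') ->
  m <= cross y y'.
Proof.
move=> mz; apply: lb_le_inf => [|_ [z Zz <-]]; last exact: mz.
by case: Z0 => z Zz; exists (mdist y z + mdist z y'), z.
Qed.

Lemma mdist_le_cross y y' : mdist y y' <= cross y y'.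
Proof. by apply: le_cross => z _; exact: metric_triangle. Qed.

Lemma dist_toD_le_cross y y' : dist_to Z y + dist_to Z y' <= cross y y'.
Proof.
apply: le_cross => z Zz; apply: lerD; first exact: dist_to_le.
by rewrite metric_sym dist_to_le.
Qed.

(** For z in Z, the triangle inequality gives cross <= 2 d(y,z) + d(y,y'), and likewise with
    d(y',z). So half of cross - d(y,y') is below both distances to Z; add the two bounds. *)
Lemma cross_le_dist_toD y y' :
  cross y y' <= dist_to Z y + dist_to Z y' + mdist y y'.
Proof.
have h : (cross y y' - mdist y y') / 2 <= dist_to Z y.
  apply: le_dist_to => z Zz.
  have := cross_le y y' Zz; have := metric_triangle z y y'.
  by rewrite [mdist z y]metric_sym; lra.
have h' : (cross y y' - mdist y y') / 2 <= dist_to Z y'.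
  apply: le_dist_to => z Zz.
  have := cross_le y y' Zz; have := metric_triangle y y' z.
  by rewrite [mdist y' z]metric_sym; lra.
lra.
Qed.

(** * Lipschitz constants of the extended map *)

Lemma mdist_glue_ext (H : hilbertType R) (phi : Y -> H) y d y' d' :
  mdist (glue_ext clZ Z0 phi (glue_pi clZ Z0 y d))
        (glue_ext clZ Z0 phi (glue_pi clZ Z0 y' d')) =
  Num.sqrt (mdist (phi y) (phi y') ^+ 2 +
    (if d == d' then dist_to Z y - dist_to Z y'
     else dist_to Z y + dist_to Z y') ^+ 2).
Proof.
rewrite mdist_norm !glue_extE; congr Num.sqrt.
rewrite /= mdist_norm; congr (_ + _).
rewrite real_normK ?num_real//.
by case: d d' => [] [] /=; rewrite !(expr0, expr1); ring.
Qed.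

(** With s the difference of the second coordinates up to sign, same and opposite sheets both
    satisfy max(d, |s|) <= D <= d + |s|; the rest is common to the two cases. *)
Lemma glue_ext_bounds (H : hilbertType R) (phi : Y -> H) (a b : R) :
    0 < a -> 0 <= b ->
    (forall y y', a * mdist y y' <= mdist (phi y) (phi y') <= b * mdist y y') ->
  forall x x', a / Num.sqrt (a ^+ 2 + 1) * mdist x x'
    <= mdist (glue_ext clZ Z0 phi x) (glue_ext clZ Z0 phi x')
    <= Num.sqrt (b ^+ 2 + 1) * mdist x x'.
Proof.
move=> a0 b0 phiab x x'.
have [y [d ->]] := glue_piP x; have [y' [d' ->]] := glue_piP x'.
rewrite mdist_glue_ext mdist_glue_pi.
set D := if _ then _ else inf _; set s := if _ then _ - _ else _.
have [lo up] := andP (phiab y y').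
have a21 : 0 < a ^+ 2 + 1 by rewrite ltr_wpDl// sqr_ge0.
have m0 := mdist_ge0 y y'; have p0 := mdist_ge0 (phi y) (phi y').
have [mD sD Dms] : [/\ mdist y y' <= D, `|s| <= D & D <= mdist y y' + `|s|].
  rewrite /D /s; case: ifP => _; split; rewrite ?lerDl//.
  - by rewrite ler_norml lerNl opprB dist_to_lip metric_sym dist_to_lip.
  - exact: mdist_le_cross.
  - by rewrite ger0_norm ?dist_toD_le_cross// addr_ge0// dist_to_ge0.
  - by rewrite ger0_norm ?addr_ge0 ?dist_to_ge0// addrC cross_le_dist_toD.
have D0 : 0 <= D := le_trans m0 mD.
have ss : s ^+ 2 = `|s| ^+ 2 by rewrite real_normK ?num_real.
have s0 := normr_ge0 s; have b21 : 0 <= b ^+ 2 + 1 by rewrite addr_ge0 ?sqr_ge0.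
have age0 := ltW a0; have a21ge0 := ltW a21.
have pos2 : 0 <= mdist (phi y) (phi y') ^+ 2 + s ^+ 2 by rewrite addr_ge0 ?sqr_ge0.
apply/andP; split.
  rewrite mulrAC ler_pdivrMr ?sqrtr_gt0// -sqrtrM//.
  rewrite -[leLHS]ger0_norm ?mulr_ge0// -sqrtr_sqr ler_sqrt ?mulr_ge0//.
  rewrite ss.
  apply: (@le_trans _ _ (((a * mdist y y') ^+ 2 + `|s| ^+ 2) * (a ^+ 2 + 1))).
    apply: (@le_trans _ _ ((a * (mdist y y' + `|s|)) ^+ 2)).
      by rewrite ler_sqr ?nnegrE ?mulr_ge0 ?addr_ge0 ?ler_pM2l.
    (* Cauchy-Schwarz for the vectors (a d, |s|) and (1, a), with its defect as an explicit
       square. *)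
    rewrite -subr_ge0 (_ : _ - _ = (a ^+ 2 * mdist y y' - `|s|) ^+ 2) ?sqr_ge0//.
    by ring.
  by rewrite ler_pM2r// lerD2r ler_sqr ?nnegrE// mulr_ge0.
rewrite -[D in leRHS]ger0_norm// -sqrtr_sqr -sqrtrM//.
(* Split (b^2 + 1) D^2: b^2 D^2 dominates the [phi] part since d <= D, and D^2 dominates s^2. *)
rewrite ler_sqrt ?mulr_ge0 ?sqr_ge0// mulrDl mul1r ss lerD//.
  rewrite -exprMn ler_sqr ?nnegrE ?mulr_ge0//.
  by rewrite (le_trans up)// ler_wpM2l.
by rewrite ler_sqr ?nnegrE.
Qed.

(** Squared and cleared of denominators, this reads (b^2 + 1)(a^2 + 1) <= 2 (b^2 + a^2). It is here
    that the normalisation a <= 1 <= b enters. *)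
Lemma lip_ratio_le (a b : R) : 0 < a <= 1 -> 1 <= b ->
  Num.sqrt (b ^+ 2 + 1) / (a / Num.sqrt (a ^+ 2 + 1))
    <= Num.sqrt 2 * Num.sqrt ((b / a) ^+ 2 + 1).
Proof.
move=> /andP[a0 a1] b1; have a_ge0 := ltW a0.
have sq1_ge0 (r : R) : 0 <= r ^+ 2 + 1 by rewrite addr_ge0 ?sqr_ge0.
rewrite invf_div mulrA ler_pdivrMr// -[X in _ <= _ * X]ger0_norm//.
rewrite -sqrtr_sqr -!sqrtrM ?mulr_ge0 ?ler0n//.
rewrite ler_sqrt ?mulr_ge0 ?sqr_ge0 ?ler0n//.
have -> : 2 * ((b / a) ^+ 2 + 1) * a ^+ 2 = 2 * (b ^+ 2 + a ^+ 2).
  by field; rewrite gt_eqF.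
rewrite -subr_ge0 (_ : _ - _ = (b ^+ 2 - 1) * (1 - a ^+ 2)); last by ring.
by rewrite mulr_ge0 ?subr_ge0 ?exprn_ege1 ?exprn_ile1.
Qed.

Lemma distortion_glue_ext_le (H : hilbertType R) (phi : Y -> H) (a b : R) :
    0 < a <= 1 -> 1 <= b ->
    (forall y y', a * mdist y y' <= mdist (phi y) (phi y') <= b * mdist y y') ->
  (distortion (glue_ext clZ Z0 phi)
    <= sqrte 2%:E * sqrte ((b / a)%:E ^+ 2 + 1))%E.
Proof.
move=> /andP[a0 a1] b1 phiab.
have b0 : 0 <= b := le_trans ler01 b1.
apply: le_trans (distortion_le_fin _ _ (glue_ext_bounds a0 b0 phiab)) _ => //.
  by rewrite divr_gt0 ?sqrtr_gt0 ?ltr_wpDl ?sqr_ge0.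
by rewrite -EFin_expe -EFinD -EFinM lee_fin lip_ratio_le ?a0.
Qed.

(** The nonempty set [Z] contains the only point of [Y], so the sheets are identified. *)
Lemma gluing_subsingleton :
  (forall y y', y = y') -> forall x x' : gluing clZ Z0, x = x'.
Proof.
move=> Ys x x'; have [y [d ->]] := glue_piP x; have [y' [d' ->]] := glue_piP x'.
apply/glue_pi_eq; right; split; first exact: Ys.
by case: Z0 => z; rewrite (Ys z y).
Qed.

End Gluing.

(** Isolates [c], so that an infimum in its place can be tested on each member. For x^2 < 2 the root
    on the right is 0 by default, and both sides hold. *)
Lemma le_sqrte_adjoint (R : realType) (x c : \bar R) : (0 <= x -> 0 <= c ->
  (x <= sqrte 2%:E * sqrte (c ^+ 2 + 1)) =
  (sqrte (x ^+ 2 * (2^-1)%:E - 1) <= c))%E.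
Proof.
case: x => [x| |]//; case: c => [c| |]//; rewrite ?lee_fin => x0 c0.
- rewrite -!expr2 -[x in LHS]ger0_norm// -[c in RHS]ger0_norm// -!sqrtr_sqr -sqrtrM//.
  rewrite !ler_sqrt ?mulr_ge0 ?addr_ge0 ?sqr_ge0//.
  by apply/idP/idP; lra.
- by rewrite !expe2 mulyy /= mulry gtr0_sg ?sqrtr_gt0// mul1e !leey.
- by rewrite !expe2 mulyy mulyr gtr0_sg ?invr_gt0// mul1e.
- by rewrite !expe2 mulyy /= mulry gtr0_sg ?sqrtr_gt0// mul1e !leey.
Qed.

(** * Distortion of the extension and the two-sided bound for c_2 *)

Local Open Scope ereal_scope.

Theorem corollary12 (R : realType) (Y : metricType R) (Z : set Y)
    (clZ : closed Z) (Z0 : Z !=set0) :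
  (forall (H' : hilbertType R) (phi : Y -> H'),
     normalized phi ->
     distortion (glue_ext clZ Z0 phi)
       <= sqrte 2%:E * sqrte (distortion phi ^+ 2 + 1))
  /\ euclidean_distortion Y <= euclidean_distortion (gluing clZ Z0)
  /\ euclidean_distortion (gluing clZ Z0)
       <= sqrte 2%:E * sqrte (euclidean_distortion Y ^+ 2 + 1).
Proof.
have bound_ge0 (c : \bar R) : 0 <= sqrte 2%:E * sqrte (c ^+ 2 + 1).
  by rewrite mule_ge0 ?sqrte_ge0.
have bound_pinfty : sqrte 2%:E * sqrte (+oo ^+ 2 + 1) = +oo :> \bar R.
  by rewrite !expe2 mulyy /= mulry gtr0_sg ?sqrtr_gt0// mul1e.
(* If [Y] has only one point, then so has the gluing, and every distortion is 0. *)
have [Y2|Y1] := pselect (exists y y' : Y, y <> y'); last first.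
  have Ys (y y' : Y) : y = y' by apply: contrapT => yy'; apply: Y1; exists y, y'.
  have Xs := @gluing_subsingleton R Y Z clZ Z0 Ys.
  split; [|split].
  - by move=> H' phi _; rewrite distortion_subsingleton.
  - apply: le_ereal_inf_tmp => _ [H [f <-]]; rewrite distortion_subsingleton//.
    by apply: ereal_inf_lbound; exists H, (f \o fun y => glue_pi clZ Z0 y true);
      exact: distortion_subsingleton.
  - apply: ereal_inf_le; exists 0 => //.
    by exists R^o, (fun=> 0%R); exact: distortion_subsingleton.
split; [|split].
- move=> H' phi nphi; have [phioo|] := eqVneq (distortion phi) +oo.
    by rewrite phioo bound_pinfty leey.
  rewrite -ltey => phioo.
  have [a [b [/andP[a0 _] la ub -> phiab]]] := distortion_finP Y2 phioo.
  have := nphi Y2 phioo; rewrite la ub !lee_fin => /andP[a1 b1].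
  by apply: distortion_glue_ext_le; rewrite ?a0.
- apply: le_ereal_inf_tmp => _ [H [f <-]].
  pose i y := glue_pi clZ Z0 y true.
  apply: (@le_trans _ _ (distortion (f \o i))).
    by apply: ereal_inf_lbound; exists H, (f \o i).
  by apply: distortion_isometry => y y'; rewrite mdist_glue_pi.
- have c2_ge0 (X : metricType R) : 0 <= euclidean_distortion X.
    by apply: le_ereal_inf_tmp => _ [H [f <-]]; exact: distortion_ge0.
  (* Pass to the adjoint form, fix one map [f] from the infimum for [Y], and return to the original
     form for that [f]. *)
  rewrite le_sqrte_adjoint//; apply: le_ereal_inf_tmp => _ [H [f <-]].
  rewrite -le_sqrte_adjoint ?distortion_ge0//.
  have [foo|] := eqVneq (distortion f) +oo; first by rewrite foo bound_pinfty leey.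
  rewrite -ltey => foo.
  have [a [b [/andP[a0 ab] _ _ -> fab]]] := distortion_finP Y2 foo.
  (* Rescaling turns the constants a, b into 1, b / a: the ratio is unchanged, and 1 <= b / a is the
     required normalisation. *)
  pose phi y : H := (a^-1 *: f y)%R.
  apply: (@le_trans _ _ (distortion (glue_ext clZ Z0 phi))).
    by apply: ereal_inf_lbound; exists (hprod H R^o), (glue_ext clZ Z0 phi).
  rewrite -[(b / a)%R]divr1; apply: distortion_glue_ext_le.
  + by rewrite ltr01 lexx.
  + by rewrite ler_pdivlMr// mul1r.
  + move=> y y'.
    have -> : (mdist (phi y) (phi y') = a^-1 * mdist (f y) (f y'))%R.
      by rewrite !mdist_norm -scalerBr normrZ gtr0_norm ?invr_gt0.
    by rewrite mul1r [(b / a)%R]mulrC -mulrA ler_pM2l ?invr_gt0// ler_pdivlMl// fab.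
Qed.
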